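(* Fix a height $h>0$ and an invariant ellipse $\{(w,d):\frac{w^2}{a^2}+\frac{d^2}{b^2}=1\}$ at height $h$ of the bouncing outer billiard map $f$ on the segment $[-1,1]\times\{0\}$ written in the coordinates $(w,h,d)$, where $a,b>0$ are the invariants of the ellipse, related by $b^2=\frac{h^2a^2}{1-a^2}$. Parametrize the ellipse by $r(\theta)=(w,d)=(a\cos\theta,b\sin\theta)$, $\theta\in S^1$, and let $\overline{f}=r^{-1}\circ f\circ r\colon S^1\to S^1$. Then there exists some $\varphi\in S^1$ such that $\overline f(\theta)=\theta+\varphi$, where $\varphi=\varphi(a)$ is a strictly increasing function, $\varphi'(a)>0$, given by $$ \varphi(a)=\begin{cases}\arctan\left(\frac{2ab}{b^2-a^2}\right)+\pi & a<b,\\[2pt] \arctan\left(\frac{2ab}{b^2-a^2}\right) & a>b,\\[2pt] \frac{3\pi}{2} & a=b,\end{cases} $$ with $$\varphi'(a)=\frac{2b}{b^2+a^2}.$$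
   Context: Bouncing outer billiard on the segment $[-1,1]\times\{0\}\subset\mathbb{R}^2$. A state is $(p,v)$ with $p=(x,h)$, $h>0$, and $v$ a unit vector at $p$ whose ray hits the segment; write $\theta=\arg(v)+\frac{\pi}{2}$. The ray is reflected off the segment at the point with first coordinate $x+h\tan\theta$, the point $p'$ is placed on the reflected ray at the same distance from the bounce point as $p$, and the new direction is obtained by reflecting the direction from $p'$ to the bounce point across the bisector of the angle at which the segment is seen from $p'$. In coordinates the map is $F(x,h,\theta)=(x',h,\theta')$ with $$x'=x+2h\tan\theta,\qquad \theta'=\theta+\arctan\left(\frac{1-x'}{h}\right)+\arctan\left(\frac{-1-x'}{h}\right),$$ so the height $h$ is preserved. The coordinate change $g(x,h,\theta)=(w,h,d)$ is $w=x+h\tan\theta$, $d=h\tan\theta$, with inverse $x=w-d$, $\theta=\arctan(d/h)$; here $w$ is the first coordinate of the bounce point. Put $f=g\circ F\circ g^{-1}$, $f(w,h,d)=(w',h,d')$; explicitly $$w'=\frac{w^3+d^2w+h^2w+2dw^2-w-2d}{w^2-d^2-h^2-1},\qquad d'=\frac{d^3+2h^2w+2d^2w+dw^2+h^2d-d}{w^2-d^2-h^2-1}.$$ The quantities $a^2=\frac{h^2w^2+d^2}{h^2+d^2}$ and $b^2=\frac{h^2w^2+d^2}{1-w^2}=\frac{h^2a^2}{1-a^2}$ are preserved by $f$, and $\frac{w^2}{a^2}+\frac{d^2}{b^2}=1$ when $a^2,b^2\neq0$; thus each such orbit lies on an ellipse in the $(w,d)$-plane, with $a,b$ taken to be the positive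 square roots of $a^2,b^2$. The symbol $\theta$ in the parametrization $r(\theta)$ of the ellipse is a new variable, unrelated to the direction angle. Here $S^1=\mathbb{R}/2\pi\mathbb{Z}$, so angles are taken modulo $2\pi$.
   Formalization: Monotonicity and φ'(a)=2b/(b²+a²) are proved with b held constant, modulo 2π via a continuous lift; with h fixed and b²=h²a²/(1−a²) varying, φ=π+2arctan(√(1−a²)/h) is strictly decreasing, so the claim as worded is false. *)

(* Defs.v *)
From HB Require Import structures.
From mathcomp Require Import all_boot all_order all_algebra.
From mathcomp Require Import generic_quotient ring_quotient.
From mathcomp Require Import all_classical all_reals all_analysis.
Set Implicit Arguments.
Unset Strict Implicit.
Unset Printing Implicit Defensive.
Import Order.TTheory GRing.Theory Num.Theory.
Import numFieldNormedType.Exports.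
Local Open Scope classical_set_scope.
Local Open Scope ring_scope.
Local Open Scope quotient_scope.

Section Billiard.
Context {R : realType}.
Implicit Types (h a b x : R) (s : R * R * R) (p : R * R).

(* A state is (x, h, theta): a point (x, h) of the plane, and the angle theta
   of its direction, measured from the downward vertical. *)
Definition bounce_map s : R * R * R :=
  let: (x, h, theta) := s in
  let x' := x + 2 * h * tan theta in
  (x', h, theta + atan ((1 - x') / h) + atan ((- 1 - x') / h)).

Definition coord_change s : R * R * R :=
  let: (x, h, theta) := s in (x + h * tan theta, h, h * tan theta).

Definition coord_change_inv s : R * R * R :=
  let: (w, h, d) := s in (w - d, h, atan (d / h)).

Definition billiard_map : R * R * R -> R * R * R :=
  coord_change \o bounce_map \o coord_change_inv.

(* [billiard_map] preserves the height h; this is its restriction to the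
   (w, d)-plane at height h. *)
Definition billiard_map_at h p : R * R :=
  let: (w', _, d') := billiard_map (p.1, h, p.2) in (w', d').

Definition ellipse a b : set (R * R) :=
  [set p | p.1 ^+ 2 / a ^+ 2 + p.2 ^+ 2 / b ^+ 2 = 1].

Definition periods : {pred R} := [pred x | `[< exists k : int, x = (2 * pi) *~ k >]].

Fact periods_zmod_closed : zmod_closed periods.
Proof.
split=> [|x y]; rewrite !inE.
  by exists 0; rewrite mulr0z.
move=> [k ->] [l ->].
by exists (k - l); rewrite mulrzBr.
Qed.

HB.instance Definition _ := GRing.isZmodClosed.Build R periods
  periods_zmod_closed.

(* S^1 = R / 2 pi Z as an additive group *)
Definition circle := Quotient.quot (GRing.ZmodClosed.clone R periods _).
HB.instance Definition _ := ZmodQuotient.on circle.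

Definition angle (x : R) : circle := \pi_circle x.

(* [repr] picks a representative in R; the choice is irrelevant, see
   [ellipse_paramE]. *)
Definition ellipse_param a b (t : circle) : R * R :=
  let x : R := repr t in (a * cos x, b * sin x).

Lemma ellipse_paramE a b x : ellipse_param a b (angle x) = (a * cos x, b * sin x).
Proof.
rewrite /ellipse_param /angle; set y := repr _.
have : y = x %[mod circle] by rewrite reprK.
move=> /eqP; rewrite -Quotient.idealrBE inE => -[k /eqP].
rewrite subr_eq addrC => /eqP ->.
have cs (n : nat) (z : R) : cos (z + (2 * pi) *+ n) = cos z /\ sin (z + (2 * pi) *+ n) = sin z.
  rewrite mulr_natl.
  by rewrite (periodicn (@cosD2pi R)) (periodicn (@sinD2pi R)).
case: (intP k) => [|n|n]; first by rewrite mulr0z addr0.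
  by rewrite -pmulrn; have [-> ->] := cs n.+1 x.
by rewrite mulrNz -pmulrn; have [<- <-] := cs n.+1 (x - (2 * pi) *+ n.+1);
  rewrite subrK.
Qed.

(* r^-1 \o f \o r; the inverse is the genuine one on [ellipse a b] as soon as
   [ellipse_param a b] is a bijection from the circle onto it. *)
Definition billiard_on_circle h a b : circle -> circle :=
  'pinv_(fun=> 0) [set: circle] (ellipse_param a b)
    \o billiard_map_at h \o ellipse_param a b.

Definition rotation b a : circle :=
  angle (if a < b then atan (2 * a * b / (b ^+ 2 - a ^+ 2)) + pi
         else if b < a then atan (2 * a * b / (b ^+ 2 - a ^+ 2))
         else 3 * pi / 2).

(* Monotonicity and derivatives of circle-valued functions are those of their
   continuous real lifts. *)
Definition circle_increasing (A : set R) (phi : R -> circle) :=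
  exists Phi : R -> R,
    [/\ {within A, continuous Phi},
        forall x, A x -> angle (Phi x) = phi x &
        forall x y, A x -> A y -> x < y -> Phi x < Phi y].

Definition circle_is_derive (phi : R -> circle) x (l : R) :=
  exists Phi : R -> R,
    (\forall y \near x, angle (Phi y) = phi y) /\ is_derive x 1 Phi l.

End Billiard.
Arguments circle R : clear implicits.

(* Main.v *)
Require Import Defs.
From mathcomp Require Import all_boot all_order all_algebra.
From mathcomp Require Import generic_quotient ring_quotient ring lra.
From mathcomp Require Import all_classical all_reals all_analysis.
Import Order.TTheory GRing.Theory Num.Theory.
Import numFieldNormedType.Exports.
Local Open Scope classical_set_scope.
Local Open Scope ring_scope.

(** Why the billiard map is a rotation on each invariant ellipse.

    Seen from [p'], the new direction is a sum of three arctangents, and the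
    tangent of such a sum is the quotient of the imaginary by the real part of a
    product of three complex numbers ([tan_atanD3]).  Hence the map is rational
    in (w, d) ([billiard_map_atE]), with denominator
    h^2 + d^2 - w^2 + 1.  The relation between a, b and h forces 0 < a < 1
    and turns that denominator, at (w, d) = (a cos t, b sin t), into
    (b^2 + a^2) (1 - a^2 cos^2 t) / a^2, which is positive.  The factor
    1 - a^2 cos^2 t also divides the numerators, and what is left is linear in
    cos t and sin t: it is the addition formula for the angle phi with
    cos phi = (a^2 - b^2) / (a^2 + b^2) and sin phi = - 2ab / (a^2 + b^2)
    ([billiard_map_ellipse_param]).

    The half-angle formulas show that this phi is 2 atan (a / b) - pi.  The
    three-case formula for the rotation angle is this one function, rewritten
    with the double-angle formula for the tangent and taken modulo 2 pi
    ([rotationE]).  Since 2 atan (a / b) - pi is smooth in a across a = b, it is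
    the lift that gives monotonicity and the derivative.

    Everything happens on the circle once one knows that an angle is determined
    by its cosine and sine ([eq_angle]); with the surjectivity of (cos, sin)
    onto the unit circle ([exists_angle]) this makes the parametrization of the
    ellipse bijective ([ellipse_param_bij]), so its inverse may be cancelled in
    the conjugated map. *)

(** Subtracting the multiple of 2 pi given by the floor of z / (2 pi) brings z
    into [0, 2 pi), and cos is injective on [0, pi]; the other half of that
    interval is reflected by r |-> 2 pi - r. *)
Lemma cos_eq1_period {R : realType} (z : R) :
  cos z = 1 -> exists k : int, z = (2 * pi) *~ k.
Proof.
move=> cz; have pi0 := pi_gt0 R.
have tp0 : 0 < 2 * (pi : R) by lra.
exists (Num.floor (z / (2 * pi))).
have /andP[] := floor_itv (z / (2 * pi)).
rewrite ler_pdivlMr // ltr_pdivrMr // intrD.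
set k := Num.floor _; rewrite -[_ *~ _ in RHS]mulrzl.
set q := _ * _ => qz zk.
have {zk} zq : z < q + 2 * pi by rewrite (lt_le_trans zk) // /q mulrDl mul1r.
have cr : cos (z - q) = 1.
  (* [ellipse_paramE] for the unit circle carries the periodicity of cos. *)
  have e : angle (z - q) = angle z.
    apply/eqP; rewrite -Quotient.idealrBE; apply/asboolP.
    by exists (- k); rewrite mulrNz /q mulrzl; ring.
  by move: (ellipse_paramE 1 1 (z - q)); rewrite e ellipse_paramE !mul1r cz => -[].
have [rpi|rpi] := leP (z - q) pi.
  apply/eqP; rewrite -subr_eq0; apply/eqP.
  by apply: cos_inj; rewrite ?in_itv /= ?cr ?cos0 //; lra.
have : 2 * pi - (z - q) = 0.
  apply: cos_inj; rewrite ?in_itv /= ?cos0; try lra.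
  by rewrite mulr_natl addrC cosD2pi cosN.
lra.
Qed.

(** If x and y share cosine and sine, then cos (x - y) = cos^2 + sin^2 = 1. *)
Lemma eq_angle {R : realType} (x y : R) :
  cos x = cos y -> sin x = sin y -> angle x = angle y.
Proof.
move=> cxy sxy; apply/eqP; rewrite -Quotient.idealrBE; apply/asboolP.
apply: cos_eq1_period.
by rewrite cosB cxy sxy -!expr2 cos2Dsin2.
Qed.

Lemma angleK {R : realType} (t : circle R) : angle (repr t) = t.
Proof. exact: reprK. Qed.

Lemma angleD {R : realType} (x y : R) : angle (x + y) = angle x + angle y.
Proof. by rewrite /angle raddfD. Qed.

Lemma exists_angle {R : realType} (u v : R) :
  u ^+ 2 + v ^+ 2 = 1 -> exists x, cos x = u /\ sin x = v.
Proof.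
move=> uv.
have u1 : -1 <= u <= 1 by nra.
have ca : cos (acos u) = u by rewrite acosK.
have sa : sin (acos u) = `|v|.
  by rewrite sin_acos // -(sqrtr_sqr v); congr Num.sqrt; lra.
have [v0|v0] := leP 0 v.
  by exists (acos u); rewrite sa ger0_norm.
by exists (- acos u); rewrite cosN sinN sa ltr0_norm // opprK.
Qed.

Lemma ellipse_param_bij {R : realType} (a b : R) : 0 < a -> 0 < b ->
  set_bij [set: circle R] (ellipse a b) (ellipse_param a b).
Proof.
move=> a0 b0; have an0 := lt0r_neq0 a0; have bn0 := lt0r_neq0 b0; split.
- move=> t _ /=; rewrite -(angleK t) ellipse_paramE /ellipse /=.
  by rewrite -!expr_div_n ![_ * _ / _]mulrAC !divff // !mul1r cos2Dsin2.
- move=> s t _ _; rewrite -(angleK s) -(angleK t) !ellipse_paramE => -[].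
  by move=> /(mulfI an0) cst /(mulfI bn0) sst; apply: eq_angle.
- move=> [w d]; rewrite /ellipse /= -!expr_div_n => /exists_angle[x [cx sx]].
  exists (angle x) => //; rewrite ellipse_paramE cx sx.
  by congr (_, _); rewrite mulrC divfK.
Qed.

Lemma cos_atan_gt0 {R : realType} (t : R) : 0 < cos (atan t).
Proof. by apply: cos_gt0_pihalf; rewrite atan_gtNpi2 atan_ltpi2. Qed.

Lemma sin_atan {R : realType} (t : R) : sin (atan t) = t * cos (atan t).
Proof.
by rewrite -{2}(atanK t) /tan divfK // lt0r_neq0 // cos_atan_gt0.
Qed.

(** Expanding sin and cos of the sum leaves the common factor
    cos (atan r) cos (atan s) cos (atan t), which never vanishes.  Applying the
    two-term addition formula for [tan] twice would need cos (atan r + atan s)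
    to be nonzero, which may fail; the three-term formula holds throughout, the
    zero-denominator case included, as both sides are then 0. *)
Lemma tan_atanD3 {R : realType} (r s t : R) :
  tan (atan r + atan s + atan t) =
  (r + s + t - r * s * t) / (1 - r * s - r * t - s * t).
Proof.
rewrite /tan !(sinD, cosD) !sin_atan.
have := cos_atan_gt0 r; have := cos_atan_gt0 s; have := cos_atan_gt0 t.
set cr := cos (atan r); set cs := cos (atan s); set ct := cos (atan t).
move=> ct0 cs0 cr0.
have c0 : cr * cs * ct != 0 by rewrite !mulf_neq0 // lt0r_neq0.
rewrite -(mulKf c0 (_ - r * s * t)) -(mulKf c0 (1 - _ - _ - _)).
set N := _ * (_ - _); set D := _ * (_ - _).
rewrite -mulf_div divff ?mul1r ?invr_eq0 //.
by congr (_ / _); rewrite /N /D; ring.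
Qed.

(** The denominator h^2 + d^2 - w^2 + 1 is the opposite of the customary
    w^2 - d^2 - h^2 - 1: in this form it is positive for |w| <= 1.  Writing w'
    as w + d + d' reflects w' = x' + h tan theta' with x' = w + d. *)
Lemma billiard_map_atE {R : realType} (h w d : R) :
  0 < h -> h ^+ 2 + d ^+ 2 - w ^+ 2 + 1 != 0 ->
  let D := h ^+ 2 + d ^+ 2 - w ^+ 2 + 1 in
  let d' := (d - d * (w + d) ^+ 2 - h ^+ 2 * (d + 2 * w)) / D in
  billiard_map_at h (w, d) = (w + d + d', d').
Proof.
move=> h0 D0 /=.
have hn0 := lt0r_neq0 h0.
rewrite /billiard_map_at /billiard_map /coord_change /bounce_map /=.
rewrite tan_atanD3 atanK.
have x'E : w - d + 2 * h * (d / h) = w + d by field.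
rewrite x'E.
set T := h * (_ / _).
suff -> : T = (d - d * (w + d) ^+ 2 - h ^+ 2 * (d + 2 * w)) /
              (h ^+ 2 + d ^+ 2 - w ^+ 2 + 1) by [].
rewrite /T.
have -> : 1 - d / h * ((1 - (w + d)) / h) - d / h * ((-1 - (w + d)) / h) -
          (1 - (w + d)) / h * ((-1 - (w + d)) / h) =
          (h ^+ 2 + d ^+ 2 - w ^+ 2 + 1) / h ^+ 2 by field.
by field; rewrite D0 hn0.
Qed.

(** A real representative of the rotation angle, chosen so that one formula
    covers a < b, a = b and a > b: it is continuous, unlike the expression with
    2ab / (b^2 - a^2), which is singular at a = b. *)
Definition rotation_lift {R : realType} (b a : R) : R := 2 * atan (a / b) - pi.

Lemma cos_rotation_lift {R : realType} (b a : R) : 0 < b ->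
  cos (rotation_lift b a) = (a ^+ 2 - b ^+ 2) / (b ^+ 2 + a ^+ 2).
Proof.
move=> b0; have bn0 := lt0r_neq0 b0.
have n0 : b ^+ 2 + a ^+ 2 != 0 by apply: lt0r_neq0; nra.
rewrite /rotation_lift cosB cospi sinpi mulr0 addr0 mulrN1 mulr_natl cos_mulr2n.
rewrite cos_atan exprVn sqr_sqrtr; last by have := sqr_ge0 (a / b); lra.
have -> : 1 + (a / b) ^+ 2 = (b ^+ 2 + a ^+ 2) / b ^+ 2 by field.
by rewrite -mulr_natl; field; rewrite n0 bn0.
Qed.

Lemma sin_rotation_lift {R : realType} (b a : R) : 0 < b ->
  sin (rotation_lift b a) = - (2 * a * b) / (b ^+ 2 + a ^+ 2).
Proof.
move=> b0; have bn0 := lt0r_neq0 b0.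
have n0 : b ^+ 2 + a ^+ 2 != 0 by apply: lt0r_neq0; nra.
rewrite /rotation_lift sinB cospi sinpi mulr0 subr0 mulrN1 mulr_natl sin_mulr2n.
rewrite sin_atan mulrCA -expr2 cos_atan exprVn sqr_sqrtr; last first.
  by have := sqr_ge0 (a / b); lra.
have -> : 1 + (a / b) ^+ 2 = (b ^+ 2 + a ^+ 2) / b ^+ 2 by field.
by rewrite -mulr_natl; field; rewrite n0 bn0.
Qed.

Lemma tan_double_atan_ratio {R : realType} (b a : R) : 0 < a -> 0 < b -> a != b ->
  tan (2 * atan (a / b)) = 2 * a * b / (b ^+ 2 - a ^+ 2).
Proof.
move=> a0 b0 ab; have bn0 := lt0r_neq0 b0.
have n0 : b ^+ 2 - a ^+ 2 != 0.
  rewrite subr_sqr mulf_neq0 ?subr_eq0 //; first by rewrite eq_sym.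
  by rewrite lt0r_neq0 ?addr_gt0.
rewrite mulr_natl tan_mulr2n ?lt0r_neq0 ?cos_atan_gt0 // atanK.
have -> : 1 - (a / b) ^+ 2 = (b ^+ 2 - a ^+ 2) / b ^+ 2 by field.
by rewrite -mulr_natl; field; rewrite n0 bn0.
Qed.

(** By [tan_double_atan_ratio] the arctangent of 2ab / (b^2 - a^2) is
    2 atan (a / b) up to a multiple of pi, found by locating atan (a / b)
    relative to pi / 4 = atan 1.  For a > b the lift is the arctangent itself;
    for a <= b it differs from the tabulated value by 2 pi. *)
Lemma rotationE {R : realType} (b a : R) : 0 < a -> 0 < b ->
  rotation b a = angle (rotation_lift b a).
Proof.
move=> a0 b0; rewrite /rotation /rotation_lift.
have pi0 := pi_gt0 R.
have period2 (x y : R) : x = y + 2 * pi -> angle x = angle y.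
  by move=> ->; rewrite mulr_natl; apply: eq_angle; rewrite ?cosD2pi ?sinD2pi.
have := atan_ltpi2 (a / b); have := atan_gtNpi2 (a / b) => lo hi.
case: ltgtP => [ab|ba|->].
- apply: period2; rewrite -tan_double_atan_ratio ?lt_eqF // tanK; first by ring.
  have t1 : atan (a / b) < pi / 4 by rewrite -atan1 lt_atan // ltr_pdivrMr ?mul1r.
  have t0 : 0 < atan (a / b) by rewrite -atan0 lt_atan // divr_gt0.
  by rewrite in_itv /=; lra.
- congr angle; rewrite -tan_double_atan_ratio ?gt_eqF //.
  have -> : tan (2 * atan (a / b)) = tan (2 * atan (a / b) - pi).
    by rewrite /tan cosB sinB cospi sinpi !mulr0 subr0 addr0 !mulrN1 invrN mulrNN.
  rewrite tanK //.
  have t1 : pi / 4 < atan (a / b) by rewrite -atan1 lt_atan // ltr_pdivlMr ?mul1r.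
  by rewrite in_itv /=; lra.
- by apply: period2; rewrite divff ?lt0r_neq0 // atan1; field.
Qed.

Lemma is_derive_rotation_lift {R : realType} (b x : R) : 0 < b ->
  is_derive x 1 (rotation_lift b) (2 * b / (b ^+ 2 + x ^+ 2)).
Proof.
move=> b0; have bn0 := lt0r_neq0 b0.
have n0 : b ^+ 2 + x ^+ 2 != 0 by apply: lt0r_neq0; nra.
have dl : is_derive x 1 (fun y : R => y / b) b^-1.
  by apply: is_derive_eq; rewrite /GRing.scale /=; ring.
have da := @is_derive1_comp R atan (fun y : R => y / b) x _ _
  (is_derive1_atan (x / b)) dl.
rewrite /rotation_lift.
have -> : 2 * b / (b ^+ 2 + x ^+ 2) = 2 * ((1 + (x / b) ^+ 2)^-1 * b^-1) - 0.
  have -> : 1 + (x / b) ^+ 2 = (b ^+ 2 + x ^+ 2) / b ^+ 2 by field.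
  by field; rewrite n0 bn0.
exact: is_deriveB.
Qed.

(** The map in the angular coordinate: the denominator and the numerator share
    the factor 1 - a^2 cos^2 t once h^2 is eliminated. *)
Lemma billiard_map_ellipse_param {R : realType} (h a b : R) (t : circle R) :
  0 < h -> 0 < a -> 0 < b -> b ^+ 2 = h ^+ 2 * a ^+ 2 / (1 - a ^+ 2) ->
  billiard_map_at h (ellipse_param a b t) = ellipse_param a b (t + rotation b a).
Proof.
move=> h0 a0 b0 bE; rewrite rotationE // -(angleK t); set x := repr t.
rewrite -angleD !ellipse_paramE cosD sinD cos_rotation_lift // sin_rotation_lift //.
have an0 := lt0r_neq0 a0; have bn0 := lt0r_neq0 b0.
(* b^2 > 0 forces the denominator 1 - a^2 to be positive (were it zero, the
   quotient would be zero). *)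
have a2_lt1 : 0 < 1 - a ^+ 2.
  by rewrite -invr_gt0 -(pmulr_rgt0 _ (_ : 0 < h ^+ 2 * a ^+ 2)) -?bE
    ?mulr_gt0 ?exprn_gt0.
have hE : h ^+ 2 = b ^+ 2 * (1 - a ^+ 2) / a ^+ 2.
  by rewrite bE; field; rewrite an0 lt0r_neq0.
have sE : sin x ^+ 2 = 1 - cos x ^+ 2 by rewrite sin2cos2.
have c2_le1 : cos x ^+ 2 <= 1 by rewrite -subr_ge0 -sE sqr_ge0.
move: (cos x) (sin x) sE c2_le1 => c s sE c2_le1.
have n0 : b ^+ 2 + a ^+ 2 != 0 by rewrite lt0r_neq0 ?addr_gt0 ?exprn_gt0.
have m0 : 1 - a ^+ 2 * c ^+ 2 != 0.
  have a2_gt0 : 0 < a ^+ 2 by rewrite exprn_gt0.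
  by apply: lt0r_neq0; nra.
have DE : h ^+ 2 + (b * s) ^+ 2 - (a * c) ^+ 2 + 1 =
    (b ^+ 2 + a ^+ 2) * (1 - a ^+ 2 * c ^+ 2) / a ^+ 2.
  by rewrite hE exprMn sE; field.
rewrite billiard_map_atE // DE; last first.
  by rewrite !mulf_neq0 ?invr_eq0 ?expf_neq0.
have NE : b * s - b * s * (a * c + b * s) ^+ 2 - h ^+ 2 * (b * s + 2 * (a * c)) =
    b * (s * (a ^+ 2 - b ^+ 2) - 2 * a * b * c) * (1 - a ^+ 2 * c ^+ 2) / a ^+ 2.
  (* Isolate s^2, so that sin^2 = 1 - cos^2 can be substituted. *)
  have -> : b * s * (a * c + b * s) ^+ 2 =
    b * s * (a * c) ^+ 2 + 2 * a * b ^+ 2 * c * s ^+ 2 + b ^+ 3 * s * s ^+ 2 by ring.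
  by rewrite hE sE; field.
by rewrite NE; congr (_, _); field; rewrite an0 ?exprMn m0 n0.
Qed.

Theorem theorem3p3 (R : realType) (h a b : R)
    (h_gt0 : 0 < h) (a_gt0 : 0 < a) (b_gt0 : 0 < b)
    (bE : b ^+ 2 = h ^+ 2 * a ^+ 2 / (1 - a ^+ 2)) :
  [/\ set_bij [set: circle R] (ellipse a b) (ellipse_param a b),
      set_fun (ellipse a b) (ellipse a b) (billiard_map_at h),
      exists phi : circle R,
        (forall t : circle R, billiard_on_circle h a b t = t + phi) /\
        phi = rotation b a,
      circle_increasing `]0, 1[ (rotation b) &
      forall x : R, 0 < x < 1 ->
        circle_is_derive (rotation b) x (2 * b / (b ^+ 2 + x ^+ 2)) /\
        0 < 2 * b / (b ^+ 2 + x ^+ 2)].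
Proof.
have bij := ellipse_param_bij a b a_gt0 b_gt0.
have [param_fun param_inj param_surj] := bij.
have conj t := billiard_map_ellipse_param h a b t h_gt0 a_gt0 b_gt0 bE.
split=> //.
- by move=> p /param_surj[t _ <-]; rewrite conj; exact: param_fun.
- exists (rotation b a); split=> // t.
  by rewrite /billiard_on_circle /= conj pinvKV // inE.
- exists (rotation_lift b); split.
  + apply: continuous_subspaceT => x.
    have [dx _] := is_derive_rotation_lift b x b_gt0.
    by apply/differentiable_continuous/derivable1_diffP.
  + by move=> x /=; rewrite in_itv /= => /andP[x0 _]; rewrite rotationE.
  + move=> x y _ _ xy; rewrite /rotation_lift ltrD2r ltr_pM2l //.
    by rewrite lt_atan // ltr_pM2r // invr_gt0.
- move=> x /andP[x0 _]; split; last first.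
    by rewrite divr_gt0 ?mulr_gt0 // addr_gt0 ?exprn_gt0.
  exists (rotation_lift b); split; last exact: is_derive_rotation_lift.
  by near=> y; rewrite rotationE //; near: y; exact: lt_nbhsr.
Unshelve. all: by end_near. Qed.
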